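(* The Hamiltonians Poisson-commute: $\{H_m,H_n\}=0$ for all $m,n\in[1,r]$.
   Context: Fix $r\ge1$; let $C$ be the Cartan matrix of type $A_r$. On Laurent polynomials in $A_1,\dots,A_{2r}$ define the Poisson bracket $\{A_i,A_j\}=\Omega_{ij}A_iA_j$ (bilinear, Leibniz), with $\Omega=\begin{bmatrix}0&C^{-1}\\-C^{-1}&0\end{bmatrix}$ in $r\times r$ blocks. Let $\mathbb{T}=\mathbb{R}^2/(2\mathbb{Z}\times(r+1)\mathbb{Z})$ and let $G$ be the bipartite graph embedded in $\mathbb{T}$ with vertices $(x,y)$, $x\in\{0,1\}$ (mod 2), $y\in\{0,\dots,r\}$, $(x,y)$ black iff $x+y$ odd; edges: for each $y\in\{0,\dots,r\}$ the horizontal segments $[0,1]\times\{y\}$ and $[1,2]\times\{y\}$, and for each $y\in\{0,\dots,r-1\}$, $x\in\{0,1\}$ the vertical segment $\{x\}\times[y,y+1]$. Faces: the annulus $(\mathbb{R}/2\mathbb{Z})\times(r,r+1)$ is labeled $0$; for $a\in[1,r]$ odd, $(0,1)\times(a-1,a)$ is labeled $a$ and $(1,2)\times(a-1,a)$ is labeled $r+a$; for $a$ even, $(1,2)\times(a-1,a)$ is labeled $a$ and $(0,1)\times(a-1,a)$ is labeled $r+a$. Face $0$ has weight $1$, face $i\in[1,2r]$ has weight $A_i$. For a perfect matching $M$, $w(M)=\prod_{e\in M}(A_iA_j)^{-1}$ with $i,j$ the faces on either side of $e$. $M_0$ is the perfect matching consisting, for each $y$, of the horizontal edge at height $y$ whose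 left endpoint ($(0,y)$ for $[0,1]\times\{y\}$, $(1,y)$ for $[1,2]\times\{y\}$) is black. For a perfect matching $M$, orient edges of $M$ black$\to$white and of $M_0$ white$\to$black, discard common edges, and let $[M]_{M_0}\in H_1(\mathbb{T},\mathbb{Z})$ be the class of the resulting oriented loops. With $\eta$ the class of a horizontal loop traversed once in the direction of decreasing $x$, $H_k:=\sum_{M:[M]_{M_0}=k\eta}w(M)/w(M_0)$, a Laurent polynomial in $A_1,\dots,A_{2r}$. *)

(* Defs.v *)
From HB Require Import structures.
From mathcomp Require Import all_boot all_order all_algebra.
From mathcomp Require Import ring.
From mathcomp Require Import finmap boolp.
From mathcomp Require Import monalg.

Set Implicit Arguments.
Unset Strict Implicit.
Unset Printing Implicit Defensive.

Import Order.TTheory GRing.Theory Num.Theory.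

Local Open Scope ring_scope.

(** * Laurent polynomials

    Laurent polynomials are the group algebra of Z^n.  [monalg] only builds
    the algebra of a monoid without nontrivial units, so only its module of
    finitely supported functions is used, and the product is defined here.
    The operations of [grpalg] are locked: otherwise unification unfolds them
    to finitely supported functions and hardly ever terminates. *)

Section Convolution.
Variables (F : comNzRingType) (K : zmodType).
Implicit Types (f g h : {malg F[K]}) (u v w : K) (b : K -> K -> F).

(* The bilinear map sending (x^u, x^v) to b(u, v) x^(u + v). *)
Definition mconv b f g : {malg F[K]} :=
  \sum_(u <- msupp f) \sum_(v <- msupp g)
    << f@_u * g@_v * b u v *g (u + v)%R >>.

Lemma mconvw (d1 d2 : {fset K}) b f g :
  (msupp f `<=` d1)%fset -> (msupp g `<=` d2)%fset ->
  mconv b f g = \sum_(u <- d1) \sum_(v <- d2)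
    << f@_u * g@_v * b u v *g (u + v)%R >>.
Proof.
move=> le1 le2; rewrite /mconv (big_fset_incl _ le1) /=.
  apply/eq_bigr=> u _; apply/big_fset_incl => // v _ /mcoeff_outdom ->.
  by rewrite mulr0 mul0r monalgU0.
move=> u _ /mcoeff_outdom fu.
by rewrite big1 // => v _; rewrite fu !mul0r monalgU0.
Qed.

Lemma mconvC b f g : mconv b f g = mconv (fun u v => b v u) g f.
Proof.
rewrite /mconv exchange_big /=.
apply/eq_bigr=> v _; apply/eq_bigr=> u _.
by rewrite [f@_u * _]mulrC [(u + v)%R]addrC.
Qed.

Lemma mconvDl b : left_distributive (mconv b) +%R.
Proof.
move=> f1 f2 g.
rewrite [in RHS](mconvw _ (fsubsetUl _ (msupp f2)) (fsubset_refl _)).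
rewrite [in RHS](mconvw _ (fsubsetUr (msupp f1) _) (fsubset_refl _)).
rewrite (mconvw _ (msuppD_le _ _) (fsubset_refl _)).
rewrite -big_split /=; apply/eq_bigr=> u _.
rewrite -big_split /=; apply/eq_bigr=> v _.
by rewrite mcoeffD !mulrDl monalgUD.
Qed.

Lemma mscaleU (a x : F) u : a *: << x *g u >> = << a * x *g u >> :> {malg F[K]}.
Proof.
apply/malgP=> v; rewrite mcoeffZ [in RHS]mcoeffU mcoeffU.
by rewrite mulrnAr.
Qed.

Lemma mconvZl b (a : F) f g : mconv b (a *: f) g = a *: mconv b f g.
Proof.
rewrite (mconvw _ (msuppZ_le _ _) (fsubset_refl _)) /mconv scaler_sumr.
apply/eq_bigr=> u _; rewrite scaler_sumr; apply/eq_bigr=> v _.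
by rewrite mscaleU mcoeffZ !mulrA.
Qed.

Lemma mconvU b x y u v :
  mconv b << x *g u >> << y *g v >> = << x * y * b u v *g (u + v)%R >>.
Proof. by rewrite (mconvw _ msuppU_le msuppU_le) !big_seq_fset1 !mcoeffUU. Qed.

End Convolution.

Definition grpalg (F : comNzRingType) (K : zmodType) : Type := {malg F[K]}.

HB.instance Definition _ (F : comNzRingType) (K : zmodType) :=
  Choice.on (grpalg F K).

HB.lock Definition lzero (F : comNzRingType) (K : zmodType) : grpalg F K :=
  (0 : {malg F[K]}).
HB.lock Definition lopp (F : comNzRingType) (K : zmodType)
    (f : grpalg F K) : grpalg F K :=
  - (f : {malg F[K]}).
HB.lock Definition ladd (F : comNzRingType) (K : zmodType)
    (f g : grpalg F K) : grpalg F K :=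
  (f : {malg F[K]}) + (g : {malg F[K]}).
HB.lock Definition lscale (F : comNzRingType) (K : zmodType)
    (a : F) (f : grpalg F K) : grpalg F K :=
  a *: (f : {malg F[K]}).
HB.lock Definition lconv (F : comNzRingType) (K : zmodType)
    (b : K -> K -> F) (f g : grpalg F K) : grpalg F K :=
  mconv b f g.
HB.lock Definition lmon (F : comNzRingType) (K : zmodType) (u : K) :
    grpalg F K :=
  << u >>.

Section GroupAlgebra.
Variables (F : comNzRingType) (K : zmodType).
Implicit Types (f g h : grpalg F K) (u v w : K).
Implicit Type b : K -> K -> F.

Local Notation lmon := (@lmon F K).

Fact laddA : associative (@ladd F K).
Proof. by rewrite ladd.unlock; exact: addrA. Qed.
Fact laddC : commutative (@ladd F K).
Proof. by rewrite ladd.unlock; exact: addrC. Qed.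
Fact ladd0 : left_id (@lzero F K) (@ladd F K).
Proof. by rewrite ladd.unlock lzero.unlock; exact: add0r. Qed.
Fact laddN : left_inverse (@lzero F K) (@lopp F K) (@ladd F K).
Proof. by rewrite ladd.unlock lzero.unlock lopp.unlock; exact: addNr. Qed.

HB.instance Definition _ := GRing.isZmodule.Build (grpalg F K)
  laddA laddC ladd0 laddN.

Fact lscaleA (a a' : F) f : lscale a (lscale a' f) = lscale (a * a') f.
Proof. by rewrite lscale.unlock; exact: scalerA. Qed.
Fact lscale1 : left_id 1 (@lscale F K).
Proof. by rewrite lscale.unlock; exact: scale1r. Qed.
Fact lscaleDr : right_distributive (@lscale F K) +%R.
Proof.
have addE f g : f + g = ladd f g by [].
by move=> a f g; rewrite !addE lscale.unlock ladd.unlock; exact: scalerDr.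
Qed.
Fact lscaleDl f : {morph (@lscale F K)^~ f : a a' / a + a'}.
Proof.
move=> a a'; rewrite lscale.unlock.
have addE g h : g + h = ladd g h by [].
by rewrite addE ladd.unlock; exact: scalerDl.
Qed.

HB.instance Definition _ := GRing.Zmodule_isLmodule.Build F (grpalg F K)
  lscaleA lscale1 lscaleDr lscaleDl.

Let addE f g : f + g = ladd f g. Proof. by []. Qed.
Let zeroE : (0 : grpalg F K) = @lzero F K. Proof. by []. Qed.
Let scaleE (a : F) f : a *: f = lscale a f. Proof. by []. Qed.

Lemma lconvC b f g : lconv b f g = lconv (fun u v => b v u) g f.
Proof. by rewrite lconv.unlock; exact: mconvC. Qed.

Lemma lconvDl b : left_distributive (lconv b) +%R.
Proof.
by move=> f g h; rewrite !addE lconv.unlock ladd.unlock; exact: mconvDl.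
Qed.

Lemma lconvDr b : right_distributive (lconv b) +%R.
Proof. by move=> f g1 g2; rewrite !(lconvC b f) lconvDl. Qed.

Lemma lconvZl b (a : F) f g : lconv b (a *: f) g = a *: lconv b f g.
Proof. by rewrite !scaleE lconv.unlock lscale.unlock; exact: mconvZl. Qed.

Lemma lconvZr b (a : F) f g : lconv b f (a *: g) = a *: lconv b f g.
Proof. by rewrite lconvC lconvZl -lconvC. Qed.

Lemma lconv0l b : left_zero 0 (lconv b).
Proof. by move=> g; rewrite -[X in lconv _ X](scale0r 0) lconvZl scale0r. Qed.

Lemma lconv0r b : right_zero 0 (lconv b).
Proof. by move=> g; rewrite lconvC lconv0l. Qed.

Lemma lconvM b u v : lconv b (lmon u) (lmon v) = b u v *: lmon (u + v).
Proof.
rewrite scaleE lconv.unlock lscale.unlock lmon.unlock mscaleU mulr1.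
by rewrite [LHS]mconvU !mul1r.
Qed.

Lemma grpalg_ind (P : grpalg F K -> Prop) :
  P 0 -> (forall f g, P f -> P g -> P (f + g)) ->
  (forall x u, P (x *: lmon u)) -> forall f, P f.
Proof.
move=> P0 PD PU f; rewrite [f]monalgE.
elim/big_ind: _ => [|g h Pg Ph|u _].
- by move: P0; rewrite zeroE lzero.unlock.
- by move: (PD _ _ Pg Ph); rewrite addE ladd.unlock.
move: (PU f@_u u); rewrite scaleE lscale.unlock lmon.unlock.
by rewrite mscaleU mulr1.
Qed.

Definition lone : grpalg F K := lmon 0.
Definition lmul : grpalg F K -> grpalg F K -> grpalg F K :=
  lconv (fun _ _ => 1).

Fact lmulA : associative lmul.
Proof.
rewrite /lmul => f g h; elim/grpalg_ind: f => [|f f' Hf Hf'|x u].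
- by rewrite !lconv0l.
- by rewrite !lconvDl Hf Hf'.
elim/grpalg_ind: g => [|g g' Hg Hg'|y v].
- by rewrite lconv0r !lconv0l lconv0r.
- by rewrite lconvDl !lconvDr lconvDl Hg Hg'.
elim/grpalg_ind: h => [|h h' Hh Hh'|z w].
- by rewrite !lconv0r.
- by rewrite !lconvDr Hh Hh'.
rewrite !(lconvZl, lconvZr) !lconvM !(lconvZl, lconvZr) !lconvM.
rewrite !scale1r !scalerA addrA; congr (_ *: _); ring.
Qed.

Fact lmulC : commutative lmul.
Proof. by move=> f g; rewrite /lmul lconvC. Qed.

Fact lmul1 : left_id lone lmul.
Proof.
rewrite /lmul => f; elim/grpalg_ind: f => [|f g Hf Hg|x u].
- by rewrite lconv0r.
- by rewrite lconvDr Hf Hg.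
by rewrite lconvZr lconvM scale1r add0r.
Qed.

Fact lmulDl : left_distributive lmul +%R.
Proof. exact: lconvDl. Qed.

Fact lone_neq0 : lone != 0.
Proof.
apply/eqP=> /(congr1 (mcoeff (0 : K))).
rewrite zeroE /lone lzero.unlock lmon.unlock mcoeffUU mcoeff0.
by apply/eqP; exact: oner_neq0.
Qed.

HB.instance Definition _ := GRing.Zmodule_isComNzRing.Build (grpalg F K)
  lmulA lmulC lmul1 lmulDl lone_neq0.

Fact lscaleAl (a : F) f g : a *: (f * g) = (a *: f) * g.
Proof. by rewrite [RHS]lconvZl. Qed.

HB.instance Definition _ :=
  GRing.Lmodule_isLalgebra.Build F (grpalg F K) lscaleAl.
HB.instance Definition _ :=
  GRing.Lalgebra_isComAlgebra.Build F (grpalg F K).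

Definition lunit : {pred grpalg F K} := fun f => `[< exists g, g * f = 1 >].
Definition linv f : grpalg F K :=
  if pselect (exists g, g * f = 1) is left fV then sval (cid fV) else f.

Fact lmulVf : {in lunit, left_inverse 1 linv *%R}.
Proof.
move=> f /asboolP fV; rewrite /linv; case: pselect => // fV'.
exact: svalP (cid fV').
Qed.

Fact lunitPl f g : g * f = 1 -> lunit f.
Proof. by move=> gf1; apply/asboolP; exists g. Qed.

Fact linv_out : {in [predC lunit], linv =1 id}.
Proof. by move=> f /asboolPn fNV; rewrite /linv; case: pselect. Qed.

HB.instance Definition _ := GRing.ComNzRing_hasMulInverse.Build (grpalg F K)
  lmulVf lunitPl linv_out.

Lemma lmon0 : lmon 0 = 1. Proof. by []. Qed.

Lemma lmonD u v : lmon (u + v) = lmon u * lmon v.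
Proof. by rewrite [RHS]lconvM scale1r. Qed.

Lemma lmonV u : (lmon u)^-1 = lmon (- u).
Proof.
have uV : lmon (- u) * lmon u = 1 by rewrite -lmonD addNr.
have uU : lmon u \is a GRing.unit by exact: lunitPl uV.
by apply: (mulIr uU); rewrite uV mulVr.
Qed.

End GroupAlgebra.

Notation laurent F n := (grpalg F 'rV[int]_n).

Definition lvar (F : comNzRingType) (n : nat) (i : 'I_n) : laurent F n :=
  lmon F (delta_mx 0 i).

(** * Poisson brackets *)

Record poisson_bracket (F : comNzRingType) (A : comAlgType F)
    (br : A -> A -> A) : Prop := PoissonBracket {
  poisson_antisym : forall f g, br f g = - br g f;
  poisson_linear : forall (c : F) f g h,
    br (c *: f + g) h = c *: br f h + br g h;
  poisson_leibniz : forall f g h, br (f * g) h = f * br g h + br f h * g;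
  poisson_jacobi : forall f g h,
    br f (br g h) + br g (br h f) + br h (br f g) = 0
}.

Definition log_canonical (F : comNzRingType) (n : nat) (S : 'M[F]_n)
    (br : laurent F n -> laurent F n -> laurent F n) : Prop :=
  forall i j : 'I_n, br (lvar F i) (lvar F j) = S i j *: (lvar F i * lvar F j).

(* Such a bracket exists for every skew-symmetric S; it is unique, being a
   biderivation with prescribed values on the variables. *)
Section LogCanonicalExists.
Variables (F : comNzRingType) (n : nat) (S : 'M[F]_n).

Let form (u v : 'rV[int]_n) : F :=
  (map_mx intr u *m S *m (map_mx intr v)^T) 0 0.

Let formDl u v w : form (u + v) w = form u w + form v w.
Proof. by rewrite /form map_mxD !mulmxDl mxE. Qed.

Let formDr u v w : form u (v + w) = form u v + form u w.
Proof. by rewrite /form map_mxD linearD /= mulmxDr mxE. Qed.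

Lemma log_canonical_exists : S^T = - S ->
  exists br, poisson_bracket br /\ log_canonical S br.
Proof.
move=> S_skew.
have formC u v : form u v = - form v u.
  rewrite /form -[in LHS](trmxK (_ *m _ *m _)) mxE !trmx_mul trmxK S_skew.
  by rewrite mulNmx mulmxN mxE mulmxA.
exists (lconv form); split; last first.
  move=> i j; rewrite [LHS]lconvM /lvar -lmonD.
  by rewrite /form !map_delta_mx -rowE trmx_delta -colE !mxE.
split.
- move=> f g; rewrite lconvC.
  elim/grpalg_ind: f => [|f f' Hf Hf'|x u].
  + by rewrite !lconv0r oppr0.
  + by rewrite !lconvDr Hf Hf' opprD.
  elim/grpalg_ind: g => [|g g' Hg Hg'|y v].
  + by rewrite !lconv0l oppr0.
  + by rewrite !lconvDl Hg Hg' opprD.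
  by rewrite !(lconvZl, lconvZr) !lconvM [form u v]formC scaleNr !scalerN.
- by move=> c f g h; rewrite lconvDl lconvZl.
- move=> f g h; elim/grpalg_ind: f => [|f f' Hf Hf'|x u].
  + by rewrite !(mul0r, lconv0l) addr0.
  + by rewrite mulrDl !lconvDl !mulrDl Hf Hf' addrACA.
  elim/grpalg_ind: g => [|g g' Hg Hg'|y v].
  + by rewrite mulr0 !lconv0l !mulr0 addr0.
  + by rewrite mulrDr !lconvDl !mulrDr Hg Hg' addrACA.
  elim/grpalg_ind: h => [|h h' Hh Hh'|z w].
  + by rewrite !lconv0r mulr0 mul0r addr0.
  + by rewrite !lconvDr mulrDl mulrDr Hh Hh' addrACA.
  rewrite -!(scalerAl, scalerAr) !(lconvZl, lconvZr) -!(scalerAl, scalerAr).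
  rewrite -lmonD !lconvM -!(scalerAl, scalerAr) -!lmonD.
  rewrite addrA [(u + w + v)%R]addrAC !scalerA -scalerDl; congr (_ *: _).
  by rewrite formDl; ring.
- move=> f g h; elim/grpalg_ind: f => [|f f' Hf Hf'|x u].
  + by rewrite !(lconv0l, lconv0r) !addr0.
  + rewrite !(lconvDl, lconvDr) -[RHS]addr0 -{1}Hf -Hf'; ring.
  elim/grpalg_ind: g => [|g g' Hg Hg'|y v].
  + by rewrite !(lconv0l, lconv0r) !addr0.
  + rewrite !(lconvDl, lconvDr) -[RHS]addr0 -{1}Hg -Hg'; ring.
  elim/grpalg_ind: h => [|h h' Hh Hh'|z w].
  + by rewrite !(lconv0l, lconv0r) !addr0.
  + rewrite !(lconvDl, lconvDr) -[RHS]addr0 -{1}Hh -Hh'; ring.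
  rewrite !(lconvZl, lconvZr) !lconvM !(lconvZl, lconvZr) !lconvM.
  have -> : (u + (v + w) = u + v + w)%R by rewrite addrA.
  have -> : (v + (w + u) = u + v + w)%R by rewrite addrA addrC addrA.
  have -> : (w + (u + v) = u + v + w)%R by rewrite addrC.
  rewrite !scalerA -!scalerDl -[RHS](scale0r (lmon F (u + v + w))).
  congr (_ *: _); rewrite !formDr (formC w u) (formC v u) (formC w v); ring.
Qed.
End LogCanonicalExists.

(** * The integrable system *)

Section Weights.
Variables (F : fieldType) (r : nat).

(* det (cartanA F r) = r + 1, so this is invertible in characteristic 0. *)
Definition cartanA : 'M[F]_r :=
  \matrix_(i < r, j < r)
    if i == j then 2
    else if (i.+1 == j :> nat) || (j.+1 == i :> nat) then -1 else 0.

Definition Omega : 'M[F]_(r + r) :=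
  block_mx 0 (invmx cartanA) (- invmx cartanA) 0.

Lemma Omega_skew : Omega^T = - Omega.
Proof.
have cartanT : cartanA^T = cartanA.
  by apply/matrixP=> i j; rewrite !mxE eq_sym orbC.
by rewrite /Omega tr_block_mx opp_block_mx !raddf0 opprK linearN /= trmx_inv
  cartanT.
Qed.

End Weights.

Section TorusGraph.
Variable r : nat.

(* The torus R^2 / (2Z x (r+1)Z) with the cell structure of the unit grid.
   The vertex (x, y) also stands for the square (x, x+1) x (y, y+1); the edge
   [inl (x, y)] is the horizontal segment [x, x+1] x {y} and the edge
   [inr (x, y)] is the vertical segment {x} x [y, y+1].  The bipartite graph
   consists of all these edges except the two vertical ones with y = r. *)
Definition vertex : finType := ('I_2 * 'I_r.+1)%type.
Definition square : finType := vertex.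
Definition edge : finType := (vertex + vertex)%type.

Implicit Types (v : vertex) (s : square) (e : edge) (M : {set edge}).

Definition stepx v : vertex := (ordS v.1, v.2).
Definition stepy v : vertex := (v.1, ordS v.2).

Definition source e : vertex := match e with inl v | inr v => v end.
Definition target e : vertex :=
  match e with inl v => stepx v | inr v => stepy v end.

Definition in_graph e : bool := if e is inr v then (v.2 < r)%N else true.

Definition black v : bool := odd (v.1 + v.2)%N.

Definition perfect_matching M : bool :=
  [forall e in M, in_graph e] &&
  [forall v, #|[set e in M | (source e == v) || (target e == v)]| == 1%N].

Definition M0 : {set edge} := [set e | if e is inl v then black v else false].

(** ** Homology of the torus *)

Definition chain1 : zmodType := {ffun edge -> int}.
Definition chain2 : zmodType := {ffun square -> int}.

Definition edge1 e : chain1 := [ffun e' => (e' == e)%:R].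

Definition bd_square s : chain1 :=
  edge1 (inl s) + edge1 (inr (stepx s)) - edge1 (inl (stepy s)) - edge1 (inr s).

Definition bd2 (c : chain2) : chain1 := \sum_s bd_square s *~ c s.

(* Two 1-cycles have the same class in H_1 of the torus. *)
Definition homologous (z z' : chain1) : Prop := exists c, z - z' = bd2 c.

Definition oriented_edge e : chain1 :=
  if black (source e) then edge1 e else - edge1 e.

(* Edges common to M and M0 cancel. *)
Definition loops M : chain1 :=
  \sum_(e in M) oriented_edge e - \sum_(e in M0) oriented_edge e.

Definition eta : chain1 := - \sum_(x < 2) edge1 (inl (x, ord0)).

(** ** Hamiltonians *)

Variable F : fieldType.

(* The variable A_a is [lvar] at index a - 1: the indices 1, ..., r and
   r + 1, ..., 2r are the two summands of 'I_(r + r).  The square with lower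
   left corner (x, y) lies in the face labeled a or r + a where a = y + 1 if
   y < r, and in the annulus if y = r. *)
Definition face_weight s : laurent F (r + r) :=
  if (insub (val s.2) : option 'I_r) is Some k then
    if odd k.+1 == (s.1 == ord0) then lvar F (lshift r k)
    else lvar F (rshift r k)
  else 1.

Definition sides e : square * square :=
  match e with
  | inl v => (v, (v.1, ord_pred v.2))
  | inr v => (v, (ord_pred v.1, v.2))
  end.

Definition weight M : laurent F (r + r) :=
  \prod_(e in M) (face_weight (sides e).1 * face_weight (sides e).2)^-1.

Definition hamiltonian (k : nat) : laurent F (r + r) :=
  \sum_(M | perfect_matching M && `[< homologous (loops M) (eta *+ k) >])
    weight M / weight M0.

End TorusGraph.

(* Main.v *)
From HB Require Import structures.
Require Import Defs.
From mathcomp Require Import all_boot all_order all_algebra.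
From mathcomp Require Import ring zify boolp.

Set Implicit Arguments.
Unset Strict Implicit.
Unset Printing Implicit Defensive.

Import Order.TTheory GRing.Theory Num.Theory.

(** Rows of the graph carry two parallel horizontal edges, so a perfect matching
    is a tiling of the heights 0, ..., r by single rows, matched by their [M0]
    edge or by the other horizontal edge, and by pairs of rows y, y + 1, matched
    by the two vertical edges between them.  Every tile other than an [M0] edge
    contributes eta to the homology class.  If f_y and d_y are the weights of
    these other tiles relative to [M0], then sum_k l^k H_k = P_(r+1)(l), where
      P_0 = 1, P_1 = 1 + l f_0,
      P_(n+2) = (1 + l f_(n+1)) P_(n+1) + l d_n P_n.
    Moreover {f_y, d_y} = f_y d_y, {f_(y+1), d_y} = - f_(y+1) d_y,
    {d_y, d_(y+1)} = d_y d_(y+1), and all other brackets vanish: this is the open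
    relativistic Toda lattice.  Writing P_n = P_n(l) and P'_n = P_n(m), one proves
      {P_n, P'_n} = 0 and
      (l - m) {P_(n+1), P'_n} =
        (l - m) P_n P'_n + m P_(n+1) P'_n - l P'_(n+1) P_n
    simultaneously by induction on n. *)

(** * Poisson brackets and the relativistic Toda recursion *)

Section PoissonTheory.
Local Open Scope ring_scope.
Variables (F : comNzRingType) (A : comAlgType F) (br : A -> A -> A).
Hypothesis br_poisson : poisson_bracket br.

Lemma poissonC f g : br f g = - br g f.
Proof. exact: poisson_antisym. Qed.

Lemma poissonDl f g h : br (f + g) h = br f h + br g h.
Proof. by have := poisson_linear br_poisson 1 f g h; rewrite !scale1r. Qed.

Lemma poissonDr f g h : br h (f + g) = br h f + br h g.
Proof. by rewrite !(poissonC h) poissonDl opprD. Qed.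

Lemma poisson0l h : br 0 h = 0.
Proof. by apply: (addIr (br 0 h)); rewrite -poissonDl !add0r. Qed.

Lemma poisson0r h : br h 0 = 0.
Proof. by rewrite poissonC poisson0l oppr0. Qed.

Lemma poissonZl c f h : br (c *: f) h = c *: br f h.
Proof.
by have := poisson_linear br_poisson c f 0 h; rewrite poisson0l !addr0.
Qed.

Lemma poissonZr c f h : br h (c *: f) = c *: br h f.
Proof. by rewrite !(poissonC h) poissonZl scalerN. Qed.

Lemma poissonMl f g h : br (f * g) h = f * br g h + br f h * g.
Proof. exact: poisson_leibniz. Qed.

Lemma poissonMr f g h : br h (f * g) = f * br h g + br h f * g.
Proof. by rewrite !(poissonC h) poissonMl opprD mulrN mulNr. Qed.

Lemma poisson1l h : br 1 h = 0.
Proof.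
have := poissonMl 1 1 h; rewrite !mul1r mulr1 => e.
by apply: (addrI (br 1 h)); rewrite -e addr0.
Qed.

Lemma poisson1r h : br h 1 = 0.
Proof. by rewrite poissonC poisson1l oppr0. Qed.

Lemma poisson_suml I (s : seq I) (P : pred I) (f : I -> A) h :
  br (\sum_(i <- s | P i) f i) h = \sum_(i <- s | P i) br (f i) h.
Proof.
by apply: (big_morph (br^~ h)) => [x y|]; rewrite ?poissonDl ?poisson0l.
Qed.

Lemma poisson_sumr I (s : seq I) (P : pred I) (f : I -> A) h :
  br h (\sum_(i <- s | P i) f i) = \sum_(i <- s | P i) br h (f i).
Proof.
by apply: (big_morph (br h)) => [x y|]; rewrite ?poissonDr ?poisson0r.
Qed.

End PoissonTheory.

(** Antisymmetry only gives 2 {f, f} = 0; the factor 2 is cancelled in characteristic 0. *)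
Lemma poisson_diag (F : numFieldType) (A : comAlgType F) (br : A -> A -> A) :
  poisson_bracket br -> forall f : A, br f f = 0%R.
Proof.
move=> br_poisson f; have /eqP := poissonC br_poisson f f.
rewrite -addr_eq0 -mulr2n -scaler_nat => /eqP e.
by rewrite -[br f f]scale1r -(@mulVf F 2%:R) ?pnatr_eq0 // -scalerA e scaler0.
Qed.

(** * Commuting continuants of the relativistic Toda recursion *)

Section RelativisticToda.
Local Open Scope ring_scope.
Variables (F : numFieldType) (A : comAlgType F) (br : A -> A -> A).
Hypothesis br_poisson : poisson_bracket br.
Variables (N : nat) (f d : nat -> A).
Hypothesis br_ff : forall i j, (i < N)%N -> (j < N)%N -> br (f i) (f j) = 0.
Hypothesis br_fd : forall i j, (i < N)%N -> (j.+1 < N)%N ->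
  br (f i) (d j) = ((i == j)%:R - (i == j.+1)%:R) * (f i * d j).
Hypothesis br_dd : forall i j, (i.+1 < N)%N -> (j.+1 < N)%N ->
  br (d i) (d j) = ((i.+1 == j)%:R - (i == j.+1)%:R) * (d i * d j).

Variable P : F -> nat -> A.
Hypothesis P0 : forall c, P c 0%N = 1.
Hypothesis P1 : forall c, (0 < N)%N -> P c 1%N = 1 + c%:A * f 0%N.
Hypothesis PSS : forall c n, (n.+1 < N)%N ->
  P c n.+2 = (1 + c%:A * f n.+1) * P c n.+1 + c%:A * d n * P c n.

Let poissonAl c h : br c%:A h = 0.
Proof. by rewrite poissonZl // poisson1l // scaler0. Qed.

Let poissonAr c h : br h c%:A = 0.
Proof. by rewrite poissonZr // poisson1r // scaler0. Qed.

Let poissonE := (poissonAl, poissonAr, poissonDl br_poisson, poissonDr br_poisson,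
  poissonMl br_poisson, poissonMr br_poisson, poisson1l br_poisson,
  poisson1r br_poisson).

(** P_n involves only f_j with j < n and d_j with j < n - 1, all of which commute with f_i for i >=
    n. *)
Lemma br_f_continuant c i n : (n <= i < N)%N -> br (f i) (P c n) = 0.
Proof.
have [m] := ubnP n; elim: m n => // m IH [|[|n]] ltnm /andP[lein ltiN].
- by rewrite P0 (poisson1r br_poisson).
- have lt0N : (0 < N)%N by apply: leq_ltn_trans ltiN.
  by rewrite P1 // !poissonE br_ff //; ring.
have ltn1 : (n.+1 < N)%N by apply: leq_trans (ltnW ltiN).
have IH1 : br (f i) (P c n.+1) = 0 by rewrite IH // (ltnW lein).
have IH0 : br (f i) (P c n) = 0 by rewrite IH ?(ltnW (ltnW lein)) // ltnW.
rewrite PSS // !poissonE br_ff // br_fd // IH1 IH0.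
rewrite (gtn_eqF (ltnW lein)) (gtn_eqF lein) /=.
by rewrite subr0 mul0r; ring.
Qed.

Lemma br_d_continuant c i n : (n <= i)%N -> (i.+1 < N)%N ->
  br (d i) (P c n) = 0.
Proof.
have [m] := ubnP n; elim: m n => // m IH [|[|n]] ltnm lein ltiN.
- by rewrite P0 (poisson1r br_poisson).
- have lt0N : (0 < N)%N by apply: leq_ltn_trans ltiN.
  rewrite P1 // !poissonE (poissonC br_poisson) br_fd //.
  by rewrite (ltn_eqF lein) /= subr0 mul0r oppr0; ring.
have ltn1 : (n.+1 < N)%N by apply: leq_trans lein (ltnW (ltnW ltiN)).
have IH1 : br (d i) (P c n.+1) = 0 by rewrite IH // ltnW.
have IH0 : br (d i) (P c n) = 0.
  by rewrite IH // ltnW // ltnW.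
rewrite PSS // !poissonE IH1 IH0.
rewrite br_dd // (poissonC br_poisson) br_fd //.
rewrite (ltn_eqF lein) (ltn_eqF (leqW lein)).
rewrite (gtn_eqF (leqW (ltnW lein))) (gtn_eqF lein) /=.
by rewrite subr0 !mul0r oppr0; ring.
Qed.

(** Among the generators in P_(n+1), only f_n and d_(n-1) fail to commute with d_n, each
    contributing a factor - d_n; the terms containing one of them add up to P_(n+1) - P_n. *)
Lemma br_d_continuantS c n : (n.+1 < N)%N ->
  br (d n) (P c n.+1) = - d n * (P c n.+1 - P c n).
Proof.
case: n => [|n] ltnN.
  have lt0N := ltnW ltnN.
  rewrite P1 // P0 !poissonE (poissonC br_poisson) br_fd //=.
  by rewrite subr0 mul1r; ring.
have ltn1 : (n.+1 < N)%N by apply: ltnW.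
rewrite PSS // !poissonE !br_d_continuant //.
rewrite br_dd // (poissonC br_poisson) br_fd //.
rewrite !eqxx (ltn_eqF (leqnn n.+2)) (gtn_eqF (leqnSn n.+1)) /=.
by ring.
Qed.

(** The commutation at n is carried along because expanding the bracket at n + 2 by the three-term
    recursion meets it. The mixed bracket is multiplied by c - c' to clear its denominator. *)
Lemma br_continuant_step c c' n : c != c' -> (n < N)%N ->
  [/\ br (P c n.+1) (P c' n.+1) = 0, br (P c n) (P c' n) = 0
    & (c - c')%:A * br (P c n.+1) (P c' n) =
      (c - c')%:A * (P c n * P c' n) + c'%:A * (P c n.+1 * P c' n)
      - c%:A * (P c' n.+1 * P c n)].
Proof.
elim: n c c' => [|n IH] c c' ncc' ltnN.
  split; first 2 last.
  - by rewrite !P1 // !P0 (poisson1r br_poisson) scalerBl; ring.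
  - rewrite !P1 // !poissonE br_ff //; ring.
  - by rewrite P0 (poisson1l br_poisson).
have ltnN' := ltnW ltnN.
have [X1 X0 Y] := IH _ _ ncc' ltnN'.
(* Exchanging c and c' gives the other mixed bracket, of P_n(c) with P_(n+1)(c'). *)
have [_ _] := IH _ _ (negbT (etrans (eq_sym _ _) (negbTE ncc'))) ltnN'.
rewrite (poissonC br_poisson) => Y'.
have canc x : (c - c')%:A * x = 0 -> x = 0.
  rewrite mulr_algl => e; have nz : c - c' != 0 by rewrite subr_eq0.
  by rewrite -[x]scale1r -(mulVf nz) -scalerA e scaler0.
have eq_f c0 k : (k <= n.+1)%N -> br (f n.+1) (P c0 k) = 0.
  by move=> lek; rewrite br_f_continuant // lek.
have eq_fr c0 k : (k <= n.+1)%N -> br (P c0 k) (f n.+1) = 0.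
  by move=> lek; rewrite (poissonC br_poisson) eq_f // oppr0.
have eq_d c0 : br (d n) (P c0 n) = 0 by rewrite br_d_continuant.
have eq_dr c0 : br (P c0 n) (d n) = 0.
  by rewrite (poissonC br_poisson) eq_d oppr0.
have eq_d1 c0 := br_d_continuantS c0 ltnN.
have eq_d1r c0 : br (P c0 n.+1) (d n) = d n * (P c0 n.+1 - P c0 n).
  by rewrite (poissonC br_poisson) eq_d1 mulNr opprK.
have eq_fd : br (f n.+1) (d n) = - (f n.+1 * d n).
  by rewrite br_fd // eqxx (gtn_eqF (leqnn _)) /= sub0r mulN1r.
have eq_df : br (d n) (f n.+1) = f n.+1 * d n.
  by rewrite (poissonC br_poisson) eq_fd opprK.
have eq_ff : br (f n.+1) (f n.+1) = 0 by rewrite br_ff.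
have eq_dd : br (d n) (d n) = 0.
  by rewrite br_dd // (gtn_eqF (leqnn _)) (ltn_eqF (leqnn _)) subr0 mul0r.
have rels := (eq_f, eq_fr, eq_d, eq_dr, eq_d1, eq_d1r, eq_fd, eq_df,
  eq_ff, eq_dd, X0, X1).
move: Y Y'; rewrite !scalerBl => /eqP; rewrite -subr_eq0 => /eqP Y.
move=> /eqP; rewrite -subr_eq0 => /eqP Y'.
split=> //.
  apply: canc; rewrite scalerBl.
  rewrite (PSS c) // (PSS c') // !poissonE !rels //.
  (* After the known brackets are substituted, a linear combination of the two mixed relations
     remains; the multipliers are the coefficients of the mixed brackets in the expansion. *)
  have := congr2 +%R (congr1 ( *%R (c'%:A * d n * (1 + c%:A * f n.+1))) Y)
    (congr1 ( *%R (c%:A * d n * (1 + c'%:A * f n.+1))) Y').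
  by rewrite !mulr0 addr0 => e; rewrite -[RHS]e; ring.
apply/eqP; rewrite -subr_eq0; apply/eqP.
rewrite !(PSS c) // (PSS c') // !poissonE !rels //.
(* Only the bracket of P_n(c) with P_(n+1)(c') is left, with coefficient c d_n. *)
have := congr1 ( *%R (c%:A * d n)) Y'.
by rewrite mulr0 => e; rewrite -[RHS]e; ring.
Qed.

Lemma br_continuant c c' n : (n <= N)%N -> br (P c n) (P c' n) = 0.
Proof.
case: n => [|n] leN; first by rewrite P0 (poisson1l br_poisson).
have [<-|/br_continuant_step/(_ leN)[]//] := eqVneq c c'.
exact: poisson_diag.
Qed.

End RelativisticToda.

(** * Extracting coefficients *)

Section PolynomialCoefficients.
Local Open Scope ring_scope.

Lemma Vandermonde_natr_unit (F : numFieldType) K :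
  Vandermonde K (\row_(j < K) (j%:R : F)) \in unitmx.
Proof.
rewrite unitmxE det_Vandermonde unitfE; apply/prodf_neq0 => i _.
apply/prodf_neq0 => j ltij; rewrite !mxE subr_eq0 eqr_nat.
by rewrite gtn_eqF.
Qed.

(** The nodes 0, ..., K - 1 are distinct in characteristic 0, so their Vandermonde matrix is
    invertible; combining the values there by column k of its inverse isolates [v k]. *)
Lemma poly_vec_eq0 (F : numFieldType) (V : lmodType F) K (v : 'I_K -> V) :
  (forall c : F, \sum_(k < K) c ^+ k *: v k = 0) -> forall k, v k = 0.
Proof.
move=> v0 k; set W := Vandermonde K (\row_(j < K) (j%:R : F)).
have WV : W *m invmx W = 1%:M by rewrite mulmxV // Vandermonde_natr_unit.
have: \sum_j invmx W j k *: (\sum_(i < K) (j%:R : F) ^+ i *: v i) = 0.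
  by apply: big1 => j _; rewrite v0 scaler0.
under eq_bigr do rewrite scaler_sumr.
rewrite exchange_big /= => <-.
rewrite (eq_bigr (fun i => (W *m invmx W) i k *: v i)).
  rewrite WV (bigD1 k) //= mxE eqxx scale1r big1 ?addr0 // => i nik.
  by rewrite mxE (negbTE nik) scale0r.
move=> i _; rewrite mxE scaler_suml; apply: eq_bigr => j _.
by rewrite !mxE scalerA mulrC.
Qed.

End PolynomialCoefficients.

(** * Perfect matchings as tilings *)

Lemma big_disjointU (R : Type) (idx : R) (op : Monoid.com_law idx) (I : finType)
    (A B : {set I}) (G : I -> R) : [disjoint A & B] ->
  \big[op/idx]_(i in A :|: B) G i =
  op (\big[op/idx]_(i in A) G i) (\big[op/idx]_(i in B) G i).
Proof.
by move=> dis; rewrite -bigU //; apply: eq_bigl => i; rewrite !inE.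
Qed.

Section Tilings.
Variable r : nat.
Implicit Types (e : edge r) (v : vertex r) (M T : {set edge r}).

Definition incident e v : bool := (source e == v) || (target e == v).

Definition degree M v : nat := \sum_(e in M) incident e v.

(** For n = r + 1 this is membership in the graph: the vertical edges with y = r, which wrap around,
    are excluded. *)
Definition edge_below n e : bool :=
  match e with inl v => v.2 < n | inr v => v.2.+1 < n end.

Definition matching_below n M : bool :=
  [forall e in M, edge_below n e] &&
  [forall v : vertex r, (v.2 < n) ==> (degree M v == 1)].

Lemma perfect_matchingE M : perfect_matching M = matching_below r.+1 M.
Proof.
congr (_ && _).
  by apply: eq_forallb => -[[x y]|[x y]] //=; rewrite ltn_ord.
apply: eq_forallb => v; rewrite ltn_ord /= /degree; congr (_ == _).
rewrite -sum1dep_card big_mkcondr /=; apply: eq_bigr => e _.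
by rewrite /incident; case: ifP.
Qed.

Lemma I2P (x : 'I_2) : x = ord0 \/ x = ord_max.
Proof. by case: x => -[|[|//]] lt; [left|right]; apply: val_inj. Qed.

(** With only two columns, each horizontal edge meets both vertices of its row. *)
Lemma incident_inl x y v : incident (inl (x, y)) v = (y == v.2).
Proof.
case: v => x' y'; rewrite /incident /= /stepx -!pair_eqE /=.
rewrite -andb_orl; suff -> : (x == x') || (ordS x == x') by [].
by case: (I2P x) => ->; case: (I2P x') => ->.
Qed.

Lemma incident_inr x (y : 'I_r.+1) v : y < r ->
  incident (inr (x, y)) v =
  (x == v.1) && ((v.2 == y :> nat) || (v.2 == y.+1 :> nat)).
Proof.
case: v => x' y' ltyr; rewrite /incident /= /stepy -!pair_eqE /= -andb_orr.
congr (_ && (_ || _)); first by rewrite eq_sym.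
by rewrite eq_sym -val_eqE /= modn_small.
Qed.

Lemma incident_source e : incident e (source e).
Proof. by rewrite /incident eqxx. Qed.

Lemma incident_target e : incident e (target e).
Proof. by rewrite /incident eqxx orbT. Qed.

Lemma degreeU M T v : [disjoint M & T] ->
  degree (M :|: T) v = degree M v + degree T v.
Proof. by move=> dis; rewrite /degree big_disjointU. Qed.

Lemma degree_gt0 M e v : e \in M -> incident e v -> 0 < degree M v.
Proof. by move=> eM ev; rewrite /degree (bigD1 e) //= ev. Qed.

Lemma edge_below_leq n k e : n <= k -> edge_below n e -> edge_below k e.
Proof. by move=> lenk; case: e => v /= lt; apply: leq_trans lenk. Qed.

(** A perfect matching of the strip of k rows starting at height n. *)
Definition tile n k T : Prop :=
  {in T, forall e, edge_below (n + k) e} /\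
  forall v, degree T v = (n <= v.2 < n + k).

Section Tile.
Variables (n k : nat) (T : {set edge r}).
Hypotheses (le_nk : n + k <= r.+1) (tileT : tile n k T).

Lemma tile_disjoint M : matching_below n M -> [disjoint T & M].
Proof.
case/andP=> /forall_inP belM _; rewrite disjoint_subset; apply/subsetP => e eT.
rewrite inE; apply/negP => /belM ebel.
have := degree_gt0 eT (incident_source e).
have lts : (source e).2 < n by case: e ebel {eT} => v //=; apply: ltnW.
by rewrite tileT.2 [n <= _]leqNgt lts.
Qed.

(** Degrees add, and T already saturates the strip, so the edges of M outside T cannot touch it and
    must lie below height n. *)
Lemma matching_belowD M : T \subset M ->
  matching_below (n + k) M = matching_below n (M :\: T).
Proof.
move=> subTM; have degM v : degree M v = degree T v + degree (M :\: T) v.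
  rewrite -degreeU; last first.
    by rewrite disjoint_sym -setI_eq0 setIC setDE setICA setICr setI0.
  by rewrite -{1}(setID M T) (setIidPr subTM).
apply/andP/andP => -[/forall_inP bel /forallP deg1]; split.
- apply/forall_inP => e eMT; have := eMT; rewrite inE => /andP[_ /bel].
  have deg0 v : n <= v.2 < n + k -> degree (M :\: T) v = 0.
    move=> /[dup] lev /andP[_ ltv]; have := deg1 v; rewrite ltv degM tileT.2 lev.
    by rewrite add1n eqSS => /eqP.
  have tch v : incident e v -> v.2 < n + k -> v.2 < n.
    move=> ev ltv; rewrite ltnNge; apply/negP => lev.
    by have := degree_gt0 eMT ev; rewrite deg0 // lev.
  have := tch _ (incident_source e); have := tch _ (incident_target e).
  case: e {eMT tch} => v /= tgt src; first exact: src.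
  (* No wrap-around: the upper end of the edge is below height n + k <= r + 1. *)
  move=> lt; rewrite modn_small in tgt; first exact: tgt.
  exact: leq_trans le_nk.
- apply/forallP => v; apply/implyP => ltv; have := deg1 v.
  rewrite (leq_trans ltv (leq_addr _ _)) degM tileT.2 leqNgt ltv.
  by rewrite add0n.
- apply/forall_inP => e eM; have [eT|neT] := boolP (e \in T).
    exact: tileT.1.
  by apply: (edge_below_leq (leq_addr _ _)); apply: bel; rewrite inE neT.
apply/forallP => v; apply/implyP => ltv; rewrite degM tileT.2 ltv andbT.
have [ltvn|levn] := ltnP v.2 n; first by have := deg1 v; rewrite ltvn.
rewrite /degree big1 // => e /bel ebel; apply/eqP; rewrite eqb0.
apply/negP => ev; have: v.2 < n; last by rewrite ltnNge levn.
case: e ebel ev => -[x y] /= lty; first by rewrite incident_inl => /eqP <-.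
rewrite incident_inr; last first.
  by rewrite -ltnS (leq_trans lty) // (leq_trans _ le_nk) ?leq_addr.
by case/andP=> _ /orP[] /eqP -> //; apply: ltnW.
Qed.

Lemma matching_belowU M :
  matching_below n M -> matching_below (n + k) (T :|: M).
Proof.
move=> mM; rewrite matching_belowD ?subsetUl // setDUl setDv set0U.
by have /setDidPl -> := (etrans (disjoint_sym _ _) (tile_disjoint mM)).
Qed.

(** Adding and removing T are inverse bijections, by [matching_belowD]. *)
Lemma sum_tile (R : nmodType) (G : {set edge r} -> R) :
  (\sum_(M | matching_below (n + k) M && (T \subset M)) G M =
   \sum_(M | matching_below n M) G (T :|: M))%R.
Proof.
rewrite (reindex_onto (fun M => T :|: M) (fun M => M :\: T)) /=; last first.
  by move=> M /andP[_ sub]; rewrite -[RHS](setID M T) (setIidPr sub).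
apply: eq_bigl => M; rewrite subsetUl andbT.
apply/andP/idP => [[mTM /eqP defM]|mM].
  by rewrite -defM -matching_belowD ?subsetUl.
rewrite matching_belowU // setDUl setDv set0U; split=> //.
by have /setDidPl -> := (etrans (disjoint_sym _ _) (tile_disjoint mM)).
Qed.

End Tile.


(** The edge of [M0] at height y: its left endpoint is black exactly when column and height have
    opposite parities. *)
Definition ground_edge y : edge r :=
  inl (if odd y then ord0 else ord_max, inord y).
Definition flip_edge y : edge r :=
  inl (if odd y then ord_max else ord0, inord y).
Definition rung (x : 'I_2) y : edge r := inr (x, inord y).
Definition rungs y : {set edge r} := [set rung ord0 y; rung ord_max y].

Lemma edge_below_subset n M :
  matching_below n M -> {in M, forall e, edge_below n e}.
Proof. by case/andP=> /forall_inP. Qed.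

Lemma tile_inl x n : n <= r -> tile n 1 [set inl (x, inord n)].
Proof.
move=> len; split=> [e|v].
  by rewrite inE => /eqP -> /=; rewrite inordK ?addn1.
rewrite /degree big_set1 incident_inl -val_eqE /= inordK // addn1 ltnS.
by rewrite -eqn_leq.
Qed.

Lemma rung_neq y : rung ord0 y != rung ord_max y.
Proof. by apply/eqP => -[]. Qed.

Lemma big_rungs (R : Type) (idx : R) (op : Monoid.com_law idx) G y :
  \big[op/idx]_(e in rungs y) G e = op (G (rung ord0 y)) (G (rung ord_max y)).
Proof. by rewrite big_setU1 ?inE ?rung_neq // big_set1. Qed.

Lemma tile_rungs n : n < r -> tile n 2 (rungs n).
Proof.
move=> ltn; have ltn1 : n < r.+1 by apply: ltnW.
split=> [e|v].
  by rewrite !inE => /orP[] /eqP -> /=; rewrite inordK ?addn2.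
rewrite /degree big_rungs /= !incident_inr inordK //.
rewrite addn2 ltnS; case: v => x y /=; case: (I2P x) => -> /=.
  by rewrite addn0; lia.
by rewrite add0n; lia.
Qed.

(** The vertical edge going up from height n is excluded by the bound on M, which leaves the two
    horizontal edges and the vertical edge going down. *)
Lemma degree_top n M x : n <= r -> matching_below n.+1 M ->
  degree M (x, inord n) =
  (ground_edge n \in M) + (flip_edge n \in M) +
  (if n is n1.+1 then rung x n1 \in M else false).
Proof.
move=> len mM; have belM := edge_below_subset mM.
have sum1 e : \sum_(e' in M) (e' == e) = (e \in M).
  rewrite big_mkcond (bigD1 e) //= eqxx big1 ?addn0; first by case: (e \in M).
  by move=> e' /negbTE ->; case: ifP.
pose c e : nat := if n is n1.+1 then e == rung x n1 else false.
have -> : (if n is n1.+1 then rung x n1 \in M else false) =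
    \sum_(e in M) c e :> nat.
  by rewrite /c; case: (n) => [|n1]; rewrite ?sum1 ?big1.
rewrite -!sum1 -!big_split /=; apply: eq_bigr => e /belM; rewrite /c {c}.
case: e => -[x' y] /= lty.
  rewrite incident_inl -val_eqE /= inordK //.
  rewrite /ground_edge /flip_edge !(inj_eq inl_inj) !xpair_eqE -!val_eqE /=.
  rewrite !inordK //.
  by case: (n) => [|n1] /=; case: (I2P x') => -> /=; case: odd;
    case: (nat_of_ord y == _).
have ltyr : y < r by lia.
rewrite incident_inr //= inordK // !add0n.
case: n len lty {mM belM} => [|n1] len lty; first by lia.
rewrite /rung !(inj_eq inr_inj) !xpair_eqE -!val_eqE /= inordK; last exact: ltnW.
by case: (x' == x :> nat) => //=; congr (nat_of_bool _); lia.
Qed.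

(** A horizontal edge adds the same degree in both columns, so degree 1 in each forces the two
    vertical edges below the top row to be both present or both absent. *)
Lemma matching_cases n M : n <= r -> matching_below n.+1 M ->
  (ground_edge n \in M) + (flip_edge n \in M) +
  (if n is n1.+1 then rungs n1 \subset M else false) = 1.
Proof.
move=> len mM; have deg1 x : degree M (x, inord n) = 1.
  case/andP: mM => _ /forallP/(_ (x, inord n)) /=.
  by rewrite inordK // ltnS leqnn => /eqP.
move: (deg1 ord0) (deg1 ord_max); rewrite !degree_top //.
case: (n) => // n1; rewrite subUset !sub1set.
by do 4![case: (_ \in M)].
Qed.

Lemma matching_below0 M : matching_below 0 M = (M == set0).
Proof.
apply/idP/eqP => [/edge_below_subset belM|->].
  by apply/setP => e; rewrite inE; apply/negP => /belM; case: e.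
apply/andP; split; first by apply/forall_inP => e; rewrite inE.
by apply/forallP => v; rewrite ltn0.
Qed.

(** Peels off the topmost tile; a pair of vertical edges lowers the height by two, hence the strong
    induction. *)
Lemma matching_below_ind (P : nat -> {set edge r} -> Prop) :
  P 0 set0 ->
  (forall n M e, n <= r -> e \in [:: ground_edge n; flip_edge n] ->
    e \notin M -> P n M -> P n.+1 (e |: M)) ->
  (forall n M, n < r -> [disjoint rungs n & M] -> P n M ->
    P n.+2 (rungs n :|: M)) ->
  forall n M, n <= r.+1 -> matching_below n M -> P n M.
Proof.
move=> P0 P1 P2 n; have [m] := ubnP n; elim: m n => // m IH [|n] ltm M len mM.
  by move: mM; rewrite matching_below0 => /eqP ->.
have edge_case x : inl (x, inord n) \in [:: ground_edge n; flip_edge n] ->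
    inl (x, inord n) \in M -> P n.+1 M.
  move=> ex exM; rewrite -(setD1K exM); apply: P1; rewrite ?setD11 //.
  apply: IH => //; first exact: ltnW.
  have le1 : n + 1 <= r.+1 by rewrite addn1.
  by rewrite -(matching_belowD le1 (tile_inl x len)) ?sub1set // addn1.
have := matching_cases len mM.
case: (boolP (_ \in M)) => [gM _|_].
  by apply: edge_case gM; rewrite inE eqxx.
case: (boolP (_ \in M)) => [fM _|_].
  by apply: edge_case fM; rewrite !inE eqxx orbT.
case: n len ltm mM {edge_case} => // n len ltm mM.
case: (boolP (_ \subset _)) => // sub _.
have ltnr : n < r by [].
have le2 : n + 2 <= r.+1 by rewrite addn2.
have mMD : matching_below n (M :\: rungs n).
  by rewrite -(matching_belowD le2 (tile_rungs ltnr) sub) addn2.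
have defM : M = rungs n :|: (M :\: rungs n).
  by rewrite -{1}(setID M (rungs n)) (setIidPr sub).
rewrite defM; apply: P2 => //.
  by have := tile_disjoint (tile_rungs ltnr) mMD.
by apply: IH => //; [apply: ltnW | apply: ltnW (ltnW len)].
Qed.

(** * Partition functions of tilings and their recursion *)

Section Partition.
Local Open Scope ring_scope.
Variables (R : comNzRingType) (w : edge r -> R).

Definition partition_below n : R :=
  \sum_(M | matching_below n M) \prod_(e in M) w e.

Lemma partition_below0 : partition_below 0 = 1.
Proof.
rewrite /partition_below (big_pred1 set0) ?big_set0 // => M.
exact: matching_below0.
Qed.

Lemma partition_belowS n : (n <= r)%N ->
  partition_below n.+1 =
  (w (ground_edge n) + w (flip_edge n)) * partition_below n +
  (if n is n1.+1 then w (rung ord0 n1) * w (rung ord_max n1) * partition_below n1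
   else 0).
Proof.
move=> len.
have sum_edge e : tile n 1 [set e] ->
    \sum_(M | matching_below n.+1 M && (e \in M)) \prod_(e in M) w e =
    w e * partition_below n.
  move=> te; rewrite -addn1; under eq_bigl do rewrite -sub1set.
  rewrite sum_tile ?addn1 // mulr_sumr; apply: eq_bigr => M mM.
  have dis := tile_disjoint te mM.
  by rewrite big_disjointU //= big_set1.
rewrite mulrDl -(sum_edge _ (tile_inl _ len)) -(sum_edge _ (tile_inl _ len)).
have -> : (if n is n1.+1 then
      w (rung ord0 n1) * w (rung ord_max n1) * partition_below n1 else 0) =
    \sum_(M | matching_below n.+1 M &&
              (if n is n1.+1 then rungs n1 \subset M else false))
      \prod_(e in M) w e.
  case: n len {sum_edge} => [|n] len.
    by under eq_bigl do rewrite andbF; rewrite big_pred0_eq.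
  have := sum_tile (n := n) (k := 2) _ (tile_rungs len)
    (fun M => \prod_(e in M) w e).
  rewrite addn2 => -> //; rewrite mulr_sumr; apply: eq_bigr => M mM.
  have dis := tile_disjoint (tile_rungs len) mM.
  by rewrite (big_disjointU _ _ dis) big_rungs.
rewrite /partition_below !(@big_mkcondr _ _ _ _ _ (matching_below n.+1)).
rewrite -!big_split.
(* Exactly one of the three conditions on the topmost tile holds, so each matching is counted
   once. *)
apply: eq_bigr => M /(matching_cases len).
case: (_ \in M); case: (_ \in M); case: n {len sum_edge} => [|n];
  rewrite /= ?(addr0, add0r) //;
  by case: (rungs n \subset M); rewrite ?(addr0, add0r).
Qed.

End Partition.

End Tilings.

(** * Brackets of monomials *)

Section MonomialBrackets.
Local Open Scope ring_scope.

Lemma int_row_ind n (P : 'rV[int]_n -> Prop) :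
  P 0 -> (forall u v, P u -> P v -> P (u + v)) -> (forall u, P u -> P (- u)) ->
  (forall i, P (delta_mx 0 i)) -> forall u, P u.
Proof.
move=> P0 PD PN Pd u; rewrite (row_sum_delta u).
apply: (big_ind P) => // i _; rewrite -[u 0 i]intz scaler_int.
have Pn k : P (delta_mx 0 i *+ k).
  by elim: k => [|k IH]; rewrite ?mulr0n // mulrS; apply: PD.
by case: (u 0 i) => k; rewrite ?NegzE ?mulrNz -?pmulrn; [|apply: PN]; apply: Pn.
Qed.

Section LogForm.
Variables (F : comNzRingType) (n : nat) (S : 'M[F]_n).

(** The logarithmic derivative of monomials is additive in the exponent, so the variables determine
    it; inverses are reached through D 1 = 0. *)
Lemma derivation_lmon (D : laurent F n -> laurent F n)
    (L : 'rV[int]_n -> laurent F n) :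
  (forall f g, D (f * g) = f * D g + D f * g) ->
  (forall u v, L (u + v) = L u + L v) ->
  (forall i, D (lvar F i) = L (delta_mx 0 i) * lvar F i) ->
  forall u, D (lmon F u) = L u * lmon F u.
Proof.
move=> DM LD Dvar.
have L0 : L 0 = 0 by apply: (addIr (L 0)); rewrite -LD !add0r.
have D1 : D 1 = 0.
  by apply: (addIr (D 1)); rewrite add0r -{3}[1]mul1r DM mul1r mulr1.
apply: int_row_ind => [|u v Du Dv|u Du|i]; last exact: Dvar.
- by rewrite L0 mul0r -lmon0 in D1 *.
- by rewrite lmonD DM Du Dv LD; ring.
have uV : lmon F u * lmon F (- u) = 1 by rewrite -lmonD subrr lmon0.
have /eqP : L u + L (- u) = 0 by rewrite -LD subrr.
rewrite addrC addr_eq0 => /eqP ->.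
have /eqP : lmon F u * D (lmon F (- u)) + L u = 0.
  by rewrite -D1 -uV DM Du -{1}[L u]mulr1 -uV; ring.
rewrite addr_eq0 => /eqP <-.
by rewrite mulrAC uV mul1r.
Qed.

Definition log_form (u v : 'rV[int]_n) : F :=
  (map_mx intr u *m S *m (map_mx intr v)^T) 0 0.

Lemma log_formDl u v w : log_form (u + v) w = log_form u w + log_form v w.
Proof. by rewrite /log_form map_mxD !mulmxDl mxE. Qed.

Lemma log_formDr u v w : log_form u (v + w) = log_form u v + log_form u w.
Proof. by rewrite /log_form map_mxD linearD /= mulmxDr mxE. Qed.

Lemma log_formNl u w : log_form (- u) w = - log_form u w.
Proof. by rewrite /log_form map_mxN !mulNmx mxE. Qed.

Lemma log_formNr u w : log_form u (- w) = - log_form u w.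
Proof. by rewrite /log_form map_mxN linearN /= mulmxN mxE. Qed.

Lemma log_form_sym u v : S^T = S -> log_form u v = log_form v u.
Proof.
move=> S_sym; rewrite /log_form -[in LHS](trmxK (_ *m _ *m _)) mxE.
by rewrite !trmx_mul trmxK S_sym mulmxA.
Qed.

Lemma log_form_delta i j : log_form (delta_mx 0 i) (delta_mx 0 j) = S i j.
Proof. by rewrite /log_form !map_delta_mx -rowE trmx_delta -colE !mxE. Qed.

Variable br : laurent F n -> laurent F n -> laurent F n.
Hypotheses (br_poisson : poisson_bracket br) (br_vars : log_canonical S br).

(** The bracket is a derivation in each slot: [derivation_lmon] is applied in the first slot against
    variables, then in the second. *)
Lemma poisson_lmon u v :
  br (lmon F u) (lmon F v) = log_form u v *: (lmon F u * lmon F v).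
Proof.
have inner j : br (lmon F u) (lvar F j) =
    log_form u (delta_mx 0 j) *: (lmon F u * lvar F j).
  transitivity (log_form u (delta_mx 0 j) *: lvar F j * lmon F u).
    apply: (derivation_lmon (D := br^~ (lvar F j))
      (L := fun u => log_form u (delta_mx 0 j) *: lvar F j)) => [f g|u1 u2|i].
    - exact: poissonMl.
    - by rewrite log_formDl scalerDl.
    by rewrite br_vars log_form_delta -scalerAl [lvar F j * _]mulrC.
  by rewrite -scalerAl mulrC.
transitivity (log_form u v *: lmon F u * lmon F v); last by rewrite scalerAl.
apply: (derivation_lmon (D := br (lmon F u))
  (L := fun v => log_form u v *: lmon F u)) => [f g|v1 v2|i].
- exact: poissonMr.
- by rewrite log_formDr scalerDl.
by rewrite inner scalerAl.
Qed.

End LogForm.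
End MonomialBrackets.

(** * The inverse Cartan form and the brackets of the tile weights *)

Section CartanForm.
Local Open Scope ring_scope.
Variables (F : numFieldType) (r : nat).
Local Notation C := (cartanA F r).

(** The columns of C become second differences of unit vectors, with no special case at the two ends
    because out-of-range indicators vanish. *)
Lemma cartanAE i j :
  C i j = (i.+1 == j.+1)%:R *+ 2 - (i.+1 == j)%:R - (i.+1 == j.+2)%:R.
Proof.
rewrite mxE -val_eqE /= !eqSS [(j.+1 == i)%N]eq_sym.
have [->|_] := eqVneq (i : nat) j.
  by rewrite (gtn_eqF (leqnn _)) (ltn_eqF (leqnn _)) !subr0.
have [ji|_] := eqVneq (i : nat) j.+1.
  by rewrite orbT ji (gtn_eqF (leqnSn _)) mul0rn !sub0r oppr0 add0r.
by rewrite orbF; case: eqP => _; rewrite mul0rn subr0 sub0r ?oppr0.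
Qed.

Lemma cartanA_tr : C^T = C.
Proof. by apply/matrixP=> i j; rewrite !mxE eq_sym orbC. Qed.

(** A kernel vector, shifted by one and extended by 0 at the indices 0 and r + 1, has zero second
    differences. It is therefore linear in the index, and its vanishing at r + 1 makes the slope 0
    in characteristic 0. *)
Lemma cartanA_unit : C \in unitmx.
Proof.
rewrite -row_free_unit -kermx_eq0; apply/rowV0P => v /sub_kermxP vC.
pose w t := \sum_i v 0 i * (i.+1 == t)%:R.
have wS (i : 'I_r) : w i.+1 = v 0 i.
  rewrite /w (bigD1 i) //= eqxx mulr1 big1 ?addr0 // => k neki.
  by rewrite eqSS (negbTE (neki : (k != i :> nat))) mulr0.
have w0 : w 0%N = 0 by rewrite /w big1 // => i _; rewrite mulr0.
have wr : w r.+1 = 0.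
  by rewrite /w big1 // => i _; rewrite eqSS (ltn_eqF (ltn_ord i)) mulr0.
have rec t : (t < r)%N -> w t.+2 = w t.+1 *+ 2 - w t.
  move=> lt; have /matrixP/(_ 0 (Ordinal lt)) := vC.
  rewrite !mxE; under eq_bigr do rewrite cartanAE /= !mulrBr mulrnAr.
  rewrite !sumrB -sumrMnl -/(w _) -/(w _) -/(w _) => /eqP.
  by rewrite subr_eq0 => /eqP.
have wlin t : (t <= r)%N -> w t = w 1%N *+ t /\ w t.+1 = w 1%N *+ t.+1.
  elim: t => [|t IH] lt; first by rewrite w0.
  have [e1 e2] := IH (ltnW lt); split=> //.
  by rewrite rec // e1 e2 -mulrnA -mulrnBr; [congr (_ *+ _)|];
    rewrite muln2 -addnn; lia.
have w1 : w 1%N = 0.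
  have [_ /eqP] := wlin r (leqnn r); rewrite wr eq_sym -mulr_natr mulf_eq0.
  by rewrite pnatr_eq0 orbF => /eqP.
apply/rowP => i; rewrite -wS !mxE.
by have [_ ->] := wlin i (ltnW (ltn_ord i)); rewrite w1 mul0rn.
Qed.

(* The fundamental weights of sl_(r+1), with the convention that the ones of
   index 0 and r + 1 vanish; up to sign, [wt] lists the weights of the vector
   representation, whose pairing under C^-1 is delta_yz - 1 / (r + 1). *)
Definition fund (y : nat) : 'rV[int]_r := \row_(j < r) (j.+1 == y)%:R.
Definition wt (y : nat) : 'rV[int]_r := fund y - fund y.+1.

(** The difference of consecutive weights is minus a column of C, which cancels C^-1 and leaves a
    coordinate of u. *)
Lemma form_wtB u z (ltzr : (z < r)%N) :
  log_form (invmx C) u (wt z - wt z.+1) = - (u 0 (Ordinal ltzr))%:~R.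
Proof.
have wtB : (map_mx intr (wt z - wt z.+1))^T =
    - (C *m (delta_mx 0 (Ordinal ltzr))^T) :> 'M[F]_(r, 1).
  apply/matrixP=> j k.
  rewrite trmx_delta -colE ord1 -[X in col _ X]cartanA_tr.
  rewrite [in RHS]mxE [in RHS]mxE [in RHS]mxE cartanAE !mxE /= !eqSS.
  rewrite !(rmorphB, rmorphMn, rmorph_nat) /= [(j == z :> nat)]eq_sym.
  by rewrite [(z == j.+1)%N]eq_sym [(z.+1 == j)%N]eq_sym rmorph1; ring.
rewrite /log_form wtB.
rewrite mulmxN mulmxA mulmxKV ?cartanA_unit // mxE.
by rewrite trmx_delta -colE !mxE.
Qed.

Lemma form_wt y z : (z < r)%N ->
  log_form (invmx C) (wt y) (wt z) - log_form (invmx C) (wt y) (wt z.+1) =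
  (y == z)%:R - (y == z.+1)%:R.
Proof.
move=> ltzr; rewrite -log_formNr -log_formDr (form_wtB _ ltzr) !mxE /= eqSS.
by rewrite rmorphB !rmorph_nat opprB eq_sym [(y == z.+1)%N]eq_sym.
Qed.

Lemma form_wt_sym y z :
  log_form (invmx C) (wt y) (wt z) = log_form (invmx C) (wt z) (wt y).
Proof. by rewrite log_form_sym // trmx_inv cartanA_tr. Qed.

Lemma Omega_form (u1 u2 v1 v2 : 'rV[int]_r) :
  log_form (Omega F r) (row_mx u1 u2) (row_mx v1 v2) =
  log_form (invmx C) u1 v2 - log_form (invmx C) u2 v1.
Proof.
rewrite /log_form !map_row_mx /Omega mul_row_block !mulmx0 add0r addr0.
by rewrite tr_row_mx mul_row_col mulmxN mulNmx addrC mxE [in X in _ + X]mxE.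
Qed.

(* The weights, relative to [M0], of the other horizontal edge at height y and
   of the pair of vertical edges between heights y and y + 1. *)
Definition flip_weight y := lmon F (row_mx (wt y) (- wt y)).
Definition dimer_weight y := lmon F (row_mx (wt y) (- wt y.+1)).

Variable br : laurent F (r + r) -> laurent F (r + r) -> laurent F (r + r).
Hypotheses (br_poisson : poisson_bracket br).
Hypothesis (br_vars : log_canonical (Omega F r) br).

(** Exponents of the shape (a, - a) form an isotropic subgroup for Omega. *)
Lemma br_flip_flip y z : br (flip_weight y) (flip_weight z) = 0.
Proof.
rewrite (poisson_lmon br_poisson br_vars) Omega_form log_formNr log_formNl.
by rewrite subrr scale0r.
Qed.

Lemma br_flip_dimer y z : (z < r)%N ->
  br (flip_weight y) (dimer_weight z) =
  ((y == z)%:R - (y == z.+1)%:R) * (flip_weight y * dimer_weight z).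
Proof.
move=> ltzr; rewrite (poisson_lmon br_poisson br_vars) Omega_form.
rewrite log_formNr log_formNl opprK addrC form_wt // -mulr_algl.
by rewrite scalerBl !scaler_nat.
Qed.

Lemma br_dimer_dimer y z : (y < r)%N -> (z < r)%N ->
  br (dimer_weight y) (dimer_weight z) =
  ((y.+1 == z)%:R - (y == z.+1)%:R) * (dimer_weight y * dimer_weight z).
Proof.
move=> ltyr ltzr; rewrite (poisson_lmon br_poisson br_vars) Omega_form.
rewrite log_formNr log_formNl -mulr_algl; congr (_ * _).
have := form_wt y ltzr; have := form_wt z ltyr.
rewrite !(form_wt_sym z) => e1 e2.
have -> : - log_form (invmx C) (wt y) (wt z.+1) -
    - log_form (invmx C) (wt y.+1) (wt z) =
    (y.+1 == z)%:R - (y == z.+1)%:R.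
  rewrite [(y.+1 == z)%N]eq_sym.
  (* The pairing of [wt y] and [wt z] is added and subtracted, to reach the two instances of
     [form_wt]. *)
  transitivity (((y == z)%:R - (y == z.+1)%:R)
                - ((z == y)%:R - (z == y.+1)%:R) : F).
    by rewrite -e1 -e2; ring.
  by rewrite (eq_sym z y); ring.
by rewrite scalerBl !scaler_nat.
Qed.

End CartanForm.

(** * Homology classes *)

Section Homology.
Local Open Scope ring_scope.
Variable r : nat.
Implicit Types (e : edge r) (v : vertex r) (M : {set edge r}) (z : chain1 r).

(** Every tile other than an [M0] edge has total 1: vertical edges occur in pairs, of which only the
    one in column 0 is counted. *)
Definition edge_class e : nat :=
  match e with inl v => ~~ black v | inr v => v.1 == ord0 end.

Definition winding M : nat := \sum_(e in M) edge_class e.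

Lemma big_M0 (R : Type) (idx : R) (op : Monoid.com_law idx) (G : edge r -> R) :
  \big[op/idx]_(e in M0 r) G e = \big[op/idx]_(y < r.+1) G (ground_edge r y).
Proof.
have -> : M0 r = [set ground_edge r (y : 'I_r.+1) | y in setT].
  apply/setP => -[[x y]|[x y]]; rewrite inE; last first.
    by apply/esym/negP => /imsetP[].
  apply/idP/imsetP => [|[k _ [-> ->]]].
    rewrite /black /= => bl; exists y => //; rewrite /ground_edge inord_val.
    congr (inl (_, _)); case: (I2P x) bl => -> /=; first by move=> ->.
    by case: (odd y).
  by rewrite /black /= inord_val; case: (boolP (odd k)) => //= /negbTE ->.
rewrite big_imset /=; first by apply: eq_bigl => y; rewrite inE.
by move=> y y' _ _ [_]; rewrite !inord_val.
Qed.

Definition boundary z := exists c, z = bd2 c.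

Lemma boundary0 : boundary 0.
Proof. by exists 0; rewrite /bd2 big1 // => s _; rewrite ffunE mulr0z. Qed.

Lemma boundaryD z z' : boundary z -> boundary z' -> boundary (z + z').
Proof.
move=> [c ->] [c' ->]; exists (c + c'); rewrite /bd2 -big_split.
by apply: eq_bigr => s _; rewrite ffunE mulrzDr.
Qed.

Lemma boundaryN z : boundary z -> boundary (- z).
Proof.
move=> [c ->]; exists (- c); rewrite /bd2 -sumrN.
by apply: eq_bigr => s _; rewrite ffunE mulrNz.
Qed.

Lemma boundary_square s : boundary (bd_square s).
Proof.
exists [ffun s' => (s' == s)%:R]; rewrite /bd2 (bigD1 s) //= ffunE eqxx mulr1z.
by rewrite big1 ?addr0 // => s' /negbTE ns; rewrite ffunE ns.
Qed.

Definition loop y : chain1 r :=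
  edge1 (inl (ord0, inord y)) + edge1 (inl (ord_max, inord y)).

Lemma eta_loop : eta r = - loop 0.
Proof.
have e0 : ord0 = inord 0 :> 'I_r.+1 by apply: val_inj; rewrite /= inordK.
rewrite /eta e0 2!big_ord_recl big_ord0 addr0 /loop.
by rewrite (_ : lift ord0 ord0 = ord_max) //; apply: val_inj.
Qed.

Lemma ordS0 : ordS (ord0 : 'I_2) = ord_max. Proof. exact: val_inj. Qed.
Lemma ordS1 : ordS (ord_max : 'I_2) = ord0. Proof. exact: val_inj. Qed.

Lemma ordS_inord y : (y < r)%N -> ordS (inord y : 'I_r.+1) = inord y.+1.
Proof.
move=> lt; apply: val_inj; rewrite /= !inordK //; last exact: ltnW.
by rewrite modn_small.
Qed.

Lemma bd_squareE x y : (y < r)%N -> bd_square (x, inord y) =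
  edge1 (inl (x, inord y)) + edge1 (inr (ordS x, inord y))
  - edge1 (inl (x, inord y.+1)) - edge1 (inr (x, inord y)) :> chain1 r.
Proof. by move=> lt; rewrite /bd_square /stepx /stepy /= ordS_inord. Qed.

(** The two squares between consecutive heights form an annulus bounded by the two horizontal
    loops. *)
Lemma boundary_loop y : (y <= r)%N -> boundary (loop y - loop 0).
Proof.
elim: y => [|y IH] ley; first by rewrite subrr; apply: boundary0.
have -> : loop y.+1 - loop 0 = loop y - loop 0
    - (bd_square (ord0, inord y) + bd_square (ord_max, inord y)).
  rewrite !bd_squareE // ordS0 ordS1 /loop; do ![move: (edge1 _) => ?].
  by apply/ffunP => e; rewrite !ffunE; ring.
apply: boundaryD; first exact: IH (ltnW ley).
by apply: boundaryN; apply: boundaryD; apply: boundary_square.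
Qed.

Lemma black_ground y : (y <= r)%N -> black (source (ground_edge r y)).
Proof.
by move=> le; rewrite /black /= inordK //; case: (boolP (odd y)) => //= /negbTE->.
Qed.

Lemma black_flip y : (y <= r)%N -> black (source (flip_edge r y)) = false.
Proof.
move=> le; rewrite /black /= inordK //.
by case: (boolP (odd y)) => //= [->|/negbTE->].
Qed.

Lemma class_ground y : (y <= r)%N -> edge_class (ground_edge r y) = 0%N.
Proof. by move=> le; have := black_ground le; rewrite /edge_class /= => ->. Qed.

Lemma class_flip y : (y <= r)%N -> edge_class (flip_edge r y) = 1%N.
Proof. by move=> le; have := black_flip le; rewrite /edge_class /= => ->. Qed.

Lemma boundary_flip y : (y <= r)%N ->
  boundary (oriented_edge (flip_edge r y) - oriented_edge (ground_edge r y)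
    - eta r).
Proof.
move=> le; rewrite /oriented_edge black_ground // black_flip // eta_loop.
have -> : - edge1 (flip_edge r y) - edge1 (ground_edge r y) - - loop 0 =
    - (loop y - loop 0).
  rewrite /flip_edge /ground_edge /loop; case: (odd y);
  do ![move: (edge1 _) => ?]; apply/ffunP => e; rewrite !ffunE; ring.
by apply: boundaryN; apply: boundary_loop.
Qed.

Lemma boundary_rungs y : (y < r)%N ->
  boundary (oriented_edge (rung r ord0 y) + oriented_edge (rung r ord_max y)
    - oriented_edge (ground_edge r y) - oriented_edge (ground_edge r y.+1)
    - eta r).
Proof.
move=> lt; rewrite /oriented_edge !black_ground ?(ltnW lt) // eta_loop.
rewrite /black /= inordK ?(leqW lt) //.
(* The square in column b has the [M0] edge at height y as its bottom. Its boundary trades this edge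
   and the two vertical edges for its top, which closes up with the [M0] edge at height y + 1 to a
   loop. *)
set b : 'I_2 := if odd y then ord0 else ord_max.
set z := (X in boundary X).
have -> : z = - bd_square (b, inord y) - (loop y.+1 - loop 0).
  rewrite bd_squareE // /z /b /ground_edge /rung /loop /=; case: (odd y);
  rewrite ?ordS0 ?ordS1 /=; do ![move: (edge1 _) => ?];
  apply/ffunP => e; rewrite !ffunE; ring.
apply: boundaryD; apply: boundaryN; first exact: boundary_square.
exact: boundary_loop.
Qed.

(** Intersection number with the vertical circle x = 1/2; it vanishes on boundaries and is -1 on
    [eta], so it separates the multiples of [eta]. *)
Definition crossing z : int := \sum_y z (inl (ord0, y)).

Fact crossing_is_zmod_morphism : zmod_morphism crossing.
Proof.
by move=> z z'; rewrite /crossing -sumrB; apply: eq_bigr => y _; rewrite !ffunE.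
Qed.

HB.instance Definition _ :=
  GRing.isZmodMorphism.Build (chain1 r) int crossing crossing_is_zmod_morphism.

Lemma crossing_inr v : crossing (edge1 (inr v)) = 0.
Proof. by rewrite /crossing big1 // => y _; rewrite ffunE. Qed.

Lemma crossing_inl v : crossing (edge1 (inl v)) = (v.1 == ord0)%:R.
Proof.
case: v => x y; rewrite /crossing (bigD1 y) //= big1 => [|y' ny]; last first.
  by rewrite ffunE (inj_eq inl_inj) xpair_eqE (negbTE ny) andbF.
by rewrite addr0 ffunE (inj_eq inl_inj) xpair_eqE eqxx andbT eq_sym.
Qed.

Lemma crossing_boundary z : boundary z -> crossing z = 0.
Proof.
move=> [c ->]; rewrite /bd2 raddf_sum big1 // => s _.
rewrite raddfMz /bd_square !raddfB raddfD /= !crossing_inl !crossing_inr /=.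
by rewrite addr0 subr0 subrr mul0rz.
Qed.

Lemma crossing_eta : crossing (eta r) = -1.
Proof. by rewrite eta_loop raddfN raddfD /= !crossing_inl. Qed.

Lemma boundary_matching n M : (n <= r.+1)%N -> matching_below n M ->
  boundary (\sum_(e in M) oriented_edge e
    - \sum_(y < n) oriented_edge (ground_edge r y) - eta r *+ winding M).
Proof.
rewrite /winding; move: n M.
apply: matching_below_ind => [|n M e len ee eM IH|n M ltn dis IH].
- by rewrite !big_set0 big_ord0 !subr0; apply: boundary0.
- rewrite !big_setU1 //= big_ord_recr /= mulrnDr.
  set x := (X in boundary X); set z := (X in boundary X) in IH.
  have -> : x = z + (oriented_edge e - oriented_edge (ground_edge r n)
      - eta r *+ edge_class e).
    by rewrite /x /z; apply/ffunP => e'; rewrite !ffunE; ring.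
  apply: boundaryD => //; move: ee; rewrite !inE => /orP[] /eqP ->.
    rewrite subrr sub0r class_ground // mulr0n oppr0.
    exact: boundary0.
  by rewrite class_flip // mulr1n; apply: boundary_flip.
rewrite !(big_disjointU _ _ dis) /= !big_ord_recr /= mulrnDr.
rewrite !big_rungs /= addn0 mulr1n.
set x := (X in boundary X); set z := (X in boundary X) in IH.
have -> : x = z + (oriented_edge (rung r ord0 n)
    + oriented_edge (rung r ord_max n) - oriented_edge (ground_edge r n)
    - oriented_edge (ground_edge r n.+1) - eta r).
  by rewrite /x /z; apply/ffunP => e'; rewrite !ffunE; ring.
by apply: boundaryD => //; apply: boundary_rungs.
Qed.

(** Adding up the tiles shows that the class is [winding M] times [eta]; [crossing] shows that no
    other multiple is homologous to it. *)
Lemma homologous_loops M k : perfect_matching M ->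
  homologous (loops M) (eta r *+ k) <-> winding M = k.
Proof.
rewrite perfect_matchingE => /(boundary_matching (leqnn _)).
rewrite -big_M0 -/(loops M) => bM; split=> [bk|<-//].
have := crossing_boundary (boundaryD bM (boundaryN bk)).
have -> : loops M - eta r *+ winding M - (loops M - eta r *+ k) =
    eta r *+ k - eta r *+ winding M by rewrite opprB addrC addrA subrK.
rewrite raddfB !raddfMn /= crossing_eta => /eqP.
by rewrite !mulNrn; lia.
Qed.

End Homology.

(** * Weights *)

Section Weights.
Local Open Scope ring_scope.
Variables (F : numFieldType) (r : nat).
Implicit Types (M : {set edge r}).

Local Notation exps u v := (row_mx u v : 'rV[int]_(r + r)).

Lemma fund0 : fund r 0 = 0.
Proof. by apply/rowP => j; rewrite !mxE. Qed.

Lemma fund_out : fund r r.+1 = 0.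
Proof. by apply/rowP => j; rewrite !mxE eqSS (ltn_eqF (ltn_ord j)). Qed.

(* The exponent of the weight of the face containing the square in column [x]
   below height [a]; the annulus is met both for a = 0 and for a = r + 1. *)
Definition face_exp (x : 'I_2) (a : nat) :=
  if odd a == (x == ord0) then exps (fund r a) 0 else exps 0 (fund r a).

Lemma fund_lshift (k : 'I_r) : exps (fund r k.+1) 0 = delta_mx 0 (lshift r k).
Proof.
apply/rowP => j; rewrite mxE; case: split_ordP => i ->; rewrite !mxE eqxx /=.
  by rewrite eq_lshift.
by rewrite eq_rlshift.
Qed.

Lemma fund_rshift (k : 'I_r) : exps 0 (fund r k.+1) = delta_mx 0 (rshift r k).
Proof.
apply/rowP => j; rewrite mxE; case: split_ordP => i ->; rewrite !mxE eqxx /=.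
  by rewrite eq_lrshift.
by rewrite eq_rshift.
Qed.

Lemma face_exp_annulus x a : fund r a = 0 -> face_exp x a = 0.
Proof. by rewrite /face_exp => ->; case: ifP; rewrite row_mx0. Qed.

Lemma face_weightE x (y : 'I_r.+1) :
  face_weight F (x, y) = lmon F (face_exp x y.+1).
Proof.
rewrite /face_weight /=; case: insubP => [k lt /= <-|] /=.
  by rewrite /face_exp fund_lshift fund_rshift /lvar /=; case: ifP.
rewrite -leqNgt => ler; rewrite face_exp_annulus ?lmon0 //.
rewrite (_ : val y = r) ?fund_out //; apply/eqP.
by rewrite eqn_leq ler -ltnS ltn_ord.
Qed.

Lemma face_weight_pred x (y : 'I_r.+1) :
  face_weight F (x, ord_pred y) = lmon F (face_exp x y).
Proof.
rewrite face_weightE /=; case: y => -[|y] lty /=.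
  by rewrite modn_small // !face_exp_annulus ?fund0 ?fund_out.
by rewrite modnDr modn_small //; apply: ltnW.
Qed.

Definition edge_weight (e : edge r) : laurent F (r + r) :=
  (face_weight F (sides e).1 * face_weight F (sides e).2)^-1.

Lemma edge_weight_inl x y : (y <= r)%N ->
  edge_weight (inl (x, inord y)) = lmon F (- (face_exp x y.+1 + face_exp x y)).
Proof.
move=> le; rewrite /edge_weight /= face_weight_pred face_weightE inordK //.
by rewrite -lmonD lmonV.
Qed.

(** For either parity of y, this edge separates the faces labeled y and r + y + 1, up to the annulus
    at the ends. *)
Lemma edge_weight_ground y : (y <= r)%N ->
  edge_weight (ground_edge r y) = lmon F (- exps (fund r y) (fund r y.+1)).
Proof.
move=> le; rewrite edge_weight_inl // /face_exp /=; case: (odd y) => /=.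
all: by rewrite add_row_mx add0r addr0.
Qed.

Lemma edge_weight_flip y : (y <= r)%N ->
  edge_weight (flip_edge r y) = edge_weight (ground_edge r y) * flip_weight F r y.
Proof.
move=> le; rewrite edge_weight_ground // edge_weight_inl // -lmonD; congr lmon.
rewrite !opp_row_mx add_row_mx /face_exp /wt opprB !addKr /=; case: (odd y) => /=.
all: by rewrite add_row_mx add0r addr0 opp_row_mx.
Qed.

(** Both vertical edges above height y separate the same two faces, labeled y + 1 and r + y + 1. *)
Lemma edge_weight_rung x y : (y < r)%N ->
  edge_weight (rung r x y) = lmon F (- exps (fund r y.+1) (fund r y.+1)).
Proof.
move=> lt; rewrite /edge_weight /= !face_weightE inordK ?(leqW lt) //.
rewrite -lmonD lmonV; congr (lmon F (- _)).
rewrite /face_exp.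
have -> : (ord_pred x == ord0) = (x != ord0) by case: (I2P x) => ->.
case: (x == ord0); case: (odd _) => /=.
all: by rewrite add_row_mx add0r addr0.
Qed.

Lemma edge_weight_rungs y : (y < r)%N ->
  edge_weight (rung r ord0 y) * edge_weight (rung r ord_max y) =
  edge_weight (ground_edge r y) * edge_weight (ground_edge r y.+1)
  * dimer_weight F r y.
Proof.
move=> lt; rewrite !edge_weight_rung // !edge_weight_ground //; last exact: ltnW.
rewrite -!lmonD; congr lmon; rewrite !opp_row_mx !add_row_mx /wt opprB.
congr row_mx; apply/rowP => j; rewrite !mxE; ring.
Qed.

End Weights.

(** * The generating function *)

Section GeneratingFunction.
Local Open Scope ring_scope.
Variables (F : numFieldType) (r : nat).
Implicit Types (c : F) (M : {set edge r}).

Definition graded_weight c (e : edge r) : laurent F (r + r) :=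
  c%:A ^+ edge_class e * edge_weight F e.

Definition ground_weight n : laurent F (r + r) :=
  \prod_(y < n) edge_weight F (ground_edge r y).

Definition normalized_partition c n : laurent F (r + r) :=
  (ground_weight n)^-1 * partition_below (graded_weight c) n.

Local Notation P := normalized_partition.

Lemma lmon_unit (u : 'rV[int]_(r + r)) : lmon F u \is a GRing.unit.
Proof.
by apply/unitrP; exists (lmon F (- u)); rewrite -!lmonD addNr subrr lmon0.
Qed.

Lemma edge_weight_ground_unit y : (y <= r)%N ->
  edge_weight F (ground_edge r y) \is a GRing.unit.
Proof. by move=> le; rewrite edge_weight_ground // lmon_unit. Qed.

Lemma ground_weight_unit n : (n <= r.+1)%N -> ground_weight n \is a GRing.unit.
Proof.
move=> le; apply: rpred_prod => y _; apply: edge_weight_ground_unit.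
by rewrite -ltnS (leq_trans (ltn_ord y)).
Qed.

(** Here u is the [M0] weight of the first n rows and m, m' are those of the next two; dividing by
    them turns the recursion for partition functions into the Toda recursion. *)
Lemma renormalize (R : comUnitRingType) (u m m' a b z z' : R) :
  u \is a GRing.unit -> m \is a GRing.unit -> m' \is a GRing.unit ->
  (u * m * m')^-1 * (m' * a * z' + m * m' * b * z) =
  a * ((u * m)^-1 * z') + b * (u^-1 * z).
Proof.
move=> uU mU mU'; have umU : u * m \is a GRing.unit by rewrite unitrM uU.
rewrite !invrM //.
transitivity (m'^-1 * m' * (a * (m^-1 * u^-1 * z')) +
    m'^-1 * m' * (m^-1 * m * (b * (u^-1 * z)))); first by ring.
by rewrite !mulVr // !mul1r.
Qed.

Lemma graded_ground c y : (y <= r)%N ->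
  graded_weight c (ground_edge r y) = edge_weight F (ground_edge r y).
Proof. by move=> le; rewrite /graded_weight class_ground // expr0 mul1r. Qed.

Lemma graded_flip c y : (y <= r)%N -> graded_weight c (flip_edge r y) =
  edge_weight F (ground_edge r y) * (c%:A * flip_weight F r y).
Proof.
move=> le; rewrite /graded_weight class_flip // expr1 edge_weight_flip //.
by rewrite mulrCA.
Qed.

Lemma graded_rungs c y : (y < r)%N ->
  graded_weight c (rung r ord0 y) * graded_weight c (rung r ord_max y) =
  edge_weight F (ground_edge r y) * edge_weight F (ground_edge r y.+1)
  * (c%:A * dimer_weight F r y).
Proof.
move=> lt; rewrite [RHS]mulrCA -edge_weight_rungs // /graded_weight.
by rewrite expr1 expr0 mul1r mulrA.
Qed.

Lemma normalized_partition0 c : P c 0 = 1.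
Proof. by rewrite /P /ground_weight big_ord0 partition_below0 invr1 mulr1. Qed.

Lemma normalized_partition1 c : P c 1 = 1 + c%:A * flip_weight F r 0.
Proof.
rewrite /P /ground_weight big_ord1 partition_belowS // partition_below0 mulr1.
rewrite addr0 graded_ground // graded_flip // mulrDr mulKr ?mulVr //.
  exact: edge_weight_ground_unit.
exact: edge_weight_ground_unit.
Qed.

Lemma normalized_partitionSS c n : (n < r)%N ->
  P c n.+2 = (1 + c%:A * flip_weight F r n.+1) * P c n.+1
             + c%:A * dimer_weight F r n * P c n.
Proof.
move=> ltn; have len := ltnW ltn.
rewrite /P partition_belowS // graded_rungs // graded_ground // graded_flip //.
rewrite /ground_weight !big_ord_recr /= -/(ground_weight n).
have mulD1 (a b : laurent F (r + r)) : a + a * b = a * (1 + b).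
  by rewrite mulrDr mulr1.
rewrite mulD1.
by rewrite renormalize ?edge_weight_ground_unit ?ground_weight_unit ?(leqW len).
Qed.

(** Bounds the degree of the generating function, so that finitely many Hamiltonians exhaust it. *)
Lemma winding_le M : (winding M <= #|edge r|)%N.
Proof.
apply: leq_trans (max_card (mem M)); rewrite -sum1_card.
by apply: leq_sum => -[v|v] _ /=; case: (X in nat_of_bool X).
Qed.

Lemma hamiltonianE k : hamiltonian r F k =
  \sum_(M | matching_below r.+1 M && (winding M == k))
    (ground_weight r.+1)^-1 * \prod_(e in M) edge_weight F e.
Proof.
rewrite /hamiltonian; apply: eq_big => M.
  rewrite -perfect_matchingE; case: (boolP (perfect_matching M)) => //= pM.
  apply/asboolP/eqP; first by move/(homologous_loops _ pM).
  by move=> e; apply/(homologous_loops _ pM).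
by move=> _; rewrite mulrC /weight [in X in X^-1]big_M0.
Qed.

Lemma sum_hamiltonian c K : (#|edge r| < K)%N ->
  \sum_(k < K) c ^+ k *: hamiltonian r F k = P c r.+1.
Proof.
move=> ltK; under eq_bigr do rewrite hamiltonianE scaler_sumr big_mkcondr.
rewrite exchange_big /P /partition_below mulr_sumr /=; apply: eq_bigr => M _.
have lt : (winding M < K)%N by apply: leq_ltn_trans (winding_le M) ltK.
have -> : \prod_(e in M) graded_weight c e =
    c%:A ^+ winding M * \prod_(e in M) edge_weight F e.
  by rewrite big_split /= prodrXr.
move: (\prod_(e in M) _) => x; rewrite (bigD1 (Ordinal lt)) //= eqxx.
rewrite big1 => [|k]; last by rewrite -val_eqE eq_sym => /negbTE ->.
by rewrite addr0 exprZn expr1n mulr_algl scalerAr.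
Qed.

End GeneratingFunction.

(** * From commuting generating functions to commuting Hamiltonians *)

Theorem theorem5p11 (F : numFieldType) (r : nat) (r_gt0 : 0 < r)
    (br : laurent F (r + r) -> laurent F (r + r) -> laurent F (r + r))
    (br_poisson : poisson_bracket br) (br_vars : log_canonical (Omega F r) br)
    (m n : nat) (m_bd : 1 <= m <= r) (n_bd : 1 <= n <= r) :
  br (hamiltonian r F m) (hamiltonian r F n) = 0%R.
Proof.
(* K exceeds every winding number, so the generating function is complete, and exceeds r, so m and n
   are valid indices. *)
pose K := (#|edge r| + r).+1.
have ltE : #|edge r| < K by rewrite ltnS leq_addr.
have ltK k : 1 <= k <= r -> k < K.
  by case/andP=> _ le; rewrite ltnS (leq_trans le) ?leq_addl.
have commute c c' :
    br (normalized_partition r c r.+1) (normalized_partition r c' r.+1) = 0%R.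
  apply: (br_continuant br_poisson (N := r.+1)
    (f := flip_weight F r) (d := dimer_weight F r)) => //.
  - by move=> i j _ _; apply: br_flip_flip.
  - by move=> i j _ lt; apply: br_flip_dimer.
  - by move=> i j lti ltj; apply: br_dimer_dimer.
  - exact: normalized_partition0.
  - by move=> c0 _; apply: normalized_partition1.
  - exact: normalized_partitionSS.
pose h (i j : 'I_K) := br (hamiltonian r F i) (hamiltonian r F j).
suff h0 i j : h i j = 0%R.
  by apply: (h0 (Ordinal (ltK m m_bd)) (Ordinal (ltK n n_bd))).
(* The bracket of the generating functions at c and c' is the sum of c^i c'^j [h i j]; coefficients
   are extracted one parameter at a time. *)
move: j; apply: poly_vec_eq0 => c'; move: i; apply: poly_vec_eq0 => c.
rewrite -[RHS](commute c c') -!(sum_hamiltonian _ ltE) (poisson_suml br_poisson).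
apply: eq_bigr => i _; rewrite (poissonZl br_poisson) (poisson_sumr br_poisson).
by congr (_ *: _)%R; apply: eq_bigr => j _; rewrite (poissonZr br_poisson).
Qed.
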